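(* Let $q$ be a prime power, $n\ge 2$ an integer, $d$ an even integer with $2\le d\le n$, and let $X(n,q)$ be the set of $n\times n$ Hermitian matrices over $\mathbb{F}_{q^2}$. Every $d$-code $Y$ in $X(n,q)$ satisfies \[ |Y|\le (-1)^{n+1}q^{n(n-d+1)}\frac{((-q)^{n-d+2}-1)+(-q)^n((-q)^{n-d+1}-1)}{(-q)^{n-d+2}-(-q)^{n-d+1}}. \]
   Context: For $x\in\mathbb{F}_{q^2}$ write $\overline{x}=x^q$; for a matrix $A$ over $\mathbb{F}_{q^2}$, $A^*$ denotes the conjugate transpose. A square matrix $A$ is Hermitian if $A^*=A$. A nonempty subset $Y\subseteq X(n,q)$ is a $d$-code if $\operatorname{rank}(A-B)\ge d$ for all distinct $A,B\in Y$. *)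

(* Defs.v *)
From HB Require Import structures.
From mathcomp Require Import all_ssreflect all_algebra all_field.
Set Implicit Arguments. Unset Strict Implicit. Unset Printing Implicit Defensive.
Import Order.TTheory GRing.Theory Num.Theory.
Local Open Scope ring_scope.

(* F plays the role of F_{q^2}; conjugation is x |-> x^q. *)
Definition hconj (F : finFieldType) (q : nat) (x : F) : F := x ^+ q.

Definition hermitian (F : finFieldType) (q n : nat) (A : 'M[F]_n) : Prop :=
  forall i j, A i j = hconj q (A j i).

Definition d_code (F : finFieldType) (q n d : nat) (Y : {set 'M[F]_n}) : Prop :=
  [/\ Y != set0,
      (forall A, A \in Y -> hermitian q A) &
      (forall A B, A \in Y -> B \in Y -> A != B -> (d <= \rank (A - B)%R)%N)].

(* Main.v *)
Require Import Defs.
From HB Require Import structures.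
From mathcomp Require Import all_ssreflect all_algebra all_field.
From mathcomp Require Import ring lra zify.
Import Order.TTheory GRing.Theory Num.Theory.
Local Open Scope ring_scope.

(* This is the linear programming bound, carried out over the rationals.
   Put [b := - q].  The kernel [theta x := q [x = 0] - 1] on the fixed field
   of the conjugation is the sum of its nontrivial additive characters, so it
   is positive semidefinite.  The Gauss sum of a Hermitian form of rank [r] on
   the space of [n] by [s] matrices is [b ^ ((2 n - r) s)]: its square is an
   orthogonality computation, and its sign is read off modulo [q + 1], as the
   norm-one scalars act freely on nonzero matrices.  Hence the Fourier
   transform of [B |-> b ^ (s (n - rank B))] at [A] counts the [V] with
   [V V^*] proportional to [A], so it vanishes when [s < rank A].  A polynomial
   of degree less than [d] in [y := b ^ (n - rank B)] that is nonnegative at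
   all ranks therefore bounds [#|Y|] by the ratio of its sum over all Hermitian
   matrices to its value at [B = 0].  The polynomial used is
   [(-1)^n (y - 1) (y - b) ... (y - b^(d-3)) (y - b^(n-1))], and its sum is
   obtained from the rank distribution of Hermitian matrices (computed by
   bordering) and the Gaussian binomial theorem. *)

Set Implicit Arguments. Unset Strict Implicit. Unset Printing Implicit Defensive.

(** * Gaussian binomials *)

Section GaussianBinomials.
Variables (R : fieldType) (b : R).

(** The base-[b] falling factorial; [b] stays arbitrary so that it can later be the negative number
    [- q]. *)
Definition qfall (x : R) j := \prod_(i < j) (x - b ^+ i).

(** Gaussian binomial coefficients, given by the Pascal rule to avoid dividing by [b ^+ k - 1]. *)
Fixpoint gbin m k : R :=
  match m, k with
  | _, 0 => 1
  | 0, _.+1 => 0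
  | m'.+1, k'.+1 => b ^+ k'.+1 * gbin m' k'.+1 + gbin m' k'
  end.

Lemma qfall0 x : qfall x 0 = 1.
Proof. by rewrite /qfall big_ord0. Qed.

Lemma qfallS x j : qfall x j.+1 = qfall x j * (x - b ^+ j).
Proof. by rewrite /qfall big_ord_recr. Qed.

Lemma qfall_scale x j : qfall (b * x) j.+1 = (b * x - 1) * (b ^+ j * qfall x j).
Proof.
rewrite /qfall big_ord_recl expr0; congr (_ * _).
elim: j => [|j IHj]; first by rewrite !big_ord0 mulr1.
by rewrite !big_ord_recr /= IHj /bump /= add1n !exprS; ring.
Qed.

Lemma qfall_expr0 m j : (m < j)%N -> qfall (b ^+ m) j = 0.
Proof. by move=> ltmj; rewrite /qfall (bigD1 (Ordinal ltmj)) //= subrr mul0r. Qed.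

(** After the first [k] factors, each remaining one is [b ^+ n - b ^+ (k + i) = b ^+ k * (b ^+ (n -
    k) - b ^+ i)]. *)
Lemma qfall_add n k j : (k <= n)%N ->
  qfall (b ^+ n) (k + j) = qfall (b ^+ n) k * (b ^+ (k * j) * qfall (b ^+ (n - k)) j).
Proof.
move=> lekn; elim: j => [|j IHj]; first by rewrite addn0 muln0 qfall0 !mulr1.
rewrite addnS !qfallS IHj mulnS; move: (qfall _ k) => c.
by rewrite -(subnKC lekn) addKn !exprD; ring.
Qed.

(** Up to the factor [b ^+ (k * j)], both sides are [qfall (b ^+ n) (k + j)]. *)
Lemma qfall_swap n k j : b != 0 -> (k <= n)%N -> (j <= n)%N ->
  qfall (b ^+ n) k * qfall (b ^+ (n - k)) j
  = qfall (b ^+ n) j * qfall (b ^+ (n - j)) k.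
Proof.
move=> b0 lekn lejn; apply: (mulfI (expf_neq0 (k * j) b0)).
by rewrite !(mulrCA (b ^+ _)) -qfall_add // addnC qfall_add // mulnC.
Qed.

Lemma gbin0 m : gbin m 0 = 1. Proof. by case: m. Qed.

Lemma gbinS m k : gbin m.+1 k.+1 = b ^+ k.+1 * gbin m k.+1 + gbin m k.
Proof. by []. Qed.

Lemma gbin_small m k : (m < k)%N -> gbin m k = 0.
Proof.
elim: m k => [|m IHm] [|k] //=; rewrite ltnS => ltmk.
by rewrite !IHm ?mulr0 ?addr0 // ltnW.
Qed.

(** The product formula with its denominator cleared. *)
Lemma gbin_qfall m k : gbin m k * qfall (b ^+ k) k = qfall (b ^+ m) k.
Proof.
elim: m k => [|m IHm] [|k]; rewrite ?gbin0 ?qfall0 ?mulr1 //.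
  by rewrite mul0r qfall_expr0.
rewrite gbinS mulrDl -mulrA IHm exprS qfall_scale exprS qfall_scale qfallS -IHm.
ring.
Qed.

(** The Gaussian binomial theorem in Cauchy's form. The induction uses [w * qfall w i = qfall w i.+1
    + b ^+ i * qfall w i]; terms with [k > m] vanish, so any [N > m] will do. *)
Lemma gbin_cauchy w m N : (m < N)%N -> \sum_(k < N) gbin m k * qfall w k = w ^+ m.
Proof.
elim: m N => [|m IHm] [|N] // ltmN.
  rewrite big_ord_recl gbin0 qfall0 big1 ?addr0 ?mulr1 // => i _.
  by rewrite mul0r.
rewrite big_ord_recl gbin0 qfall0 /=.
under eq_bigr => i _ do rewrite mulrDl.
rewrite big_split /= addrA exprSr -(IHm N ltmN) mulr_suml.
have -> : 1 * 1 + \sum_(i < N) b ^+ i.+1 * gbin m i.+1 * qfall w i.+1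
        = \sum_(i < N.+1) b ^+ i * (gbin m i * qfall w i).
  rewrite big_ord_recl gbin0 qfall0 expr0 !mul1r; congr (_ + _).
  by apply: eq_bigr => i _; rewrite mulrA.
rewrite big_ord_recr /= (@gbin_small m N) // mul0r mulr0 addr0 -big_split /=.
by apply: eq_bigr => i _; rewrite qfallS; ring.
Qed.

(* For [b = - q], the number of Hermitian [n] by [n] matrices of rank [k]. *)
Definition rank_weight n k := gbin n k * qfall (- b ^+ n) k.

Hypothesis b0 : b != 0.
Hypothesis bX1 : forall k, (0 < k)%N -> b ^+ k != 1.

Lemma qfall_diag_neq0 k : qfall (b ^+ k) k != 0.
Proof.
elim: k => [|k IHk]; first by rewrite qfall0 oner_neq0.
by rewrite exprS qfall_scale !mulf_neq0 ?expf_neq0 // -exprS subr_eq0 bX1.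
Qed.

Lemma rank_weight_qfall n k :
  rank_weight n k * qfall (b ^+ k) k = qfall (b ^+ n) k * qfall (- b ^+ n) k.
Proof. by rewrite /rank_weight mulrAC gbin_qfall. Qed.

(** With [b = - q], the coefficients count the borders that raise the rank by 0, 1 and 2. Clearing
    denominators leaves a polynomial identity in [b], [b ^+ n] and [b ^+ k]. *)
Lemma rank_weight_rec n k :
  rank_weight n.+1 k.+2 = b ^+ (2 * k.+2) * rank_weight n k.+2
    - (b + 1) * b ^+ (2 * k.+1) * rank_weight n k.+1
    - b * (b ^+ (2 * n) - b ^+ (2 * k)) * rank_weight n k.
Proof.
apply: (mulIf (qfall_diag_neq0 k.+2)); rewrite rank_weight_qfall.
set X := b ^+ n; set u := b ^+ k.
have E1 : qfall (b ^+ k.+2) k.+2 = (b * (b * u) - 1) * (b * u * qfall (b ^+ k.+1) k.+1).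
  by rewrite exprS qfall_scale !exprS.
have E2 : qfall (b ^+ k.+1) k.+1 = (b * u - 1) * (u * qfall (b ^+ k) k).
  by rewrite exprS qfall_scale.
transitivity (b ^+ (2 * k.+2) * (rank_weight n k.+2 * qfall (b ^+ k.+2) k.+2)
    - (b + 1) * b ^+ (2 * k.+1) * (b * (b * u) - 1) * (b * u)
      * (rank_weight n k.+1 * qfall (b ^+ k.+1) k.+1)
    - b * (b ^+ (2 * n) - b ^+ (2 * k)) * (b * (b * u) - 1) * (b * u) * (b * u - 1) * u
      * (rank_weight n k * qfall (b ^+ k) k)); last by rewrite E1 E2; ring.
rewrite !rank_weight_qfall exprS -mulrN !qfall_scale -/X !qfallS !mul2n -!addnn !exprD !exprS.
by rewrite -/u -/X; ring.
Qed.

(** The recurrence transposed onto the test function, the shape in which bordering produces it. *)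
Lemma sum_rank_weightS n (g : nat -> R) :
  \sum_(k < n.+2) rank_weight n.+1 k * g k =
  \sum_(k < n.+1) rank_weight n k * (b ^+ (2 * k) * g k
    - (b + 1) * b ^+ (2 * k) * g k.+1
    - b * (b ^+ (2 * n) - b ^+ (2 * k)) * g k.+2).
Proof.
have rank_weight0 m k : (m < k)%N -> rank_weight m k = 0.
  by move=> ?; rewrite /rank_weight gbin_small ?mul0r.
under [RHS]eq_bigr => i _ do rewrite !mulrBr.
rewrite !sumrB.
(* All ranges are padded with zero weights, so that after the first terms are split off the sums run
   over the same indices. *)
have -> : \sum_(i < n.+1) rank_weight n i * (b ^+ (2 * i) * g i)
        = \sum_(i < n.+3) rank_weight n i * (b ^+ (2 * i) * g i).
  by rewrite [RHS]big_ord_recr [X in _ = X + _]big_ord_recr /= !rank_weight0 ?mul0r ?addr0.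
have -> : \sum_(i < n.+1) rank_weight n i * ((b + 1) * b ^+ (2 * i) * g i.+1)
        = \sum_(i < n.+2) rank_weight n i * ((b + 1) * b ^+ (2 * i) * g i.+1).
  by rewrite [RHS]big_ord_recr /= !rank_weight0 ?mul0r ?addr0.
have -> : \sum_(k < n.+2) rank_weight n.+1 k * g k = \sum_(k < n.+3) rank_weight n.+1 k * g k.
  by rewrite [RHS]big_ord_recr /= !rank_weight0 ?mul0r ?addr0.
rewrite [in LHS]big_ord_recl [in LHS]big_ord_recl.
rewrite [X in _ = X - _ - _]big_ord_recl [X in _ = _ + X - _ - _]big_ord_recl.
rewrite [X in _ = _ - X - _]big_ord_recl /=.
under eq_bigr => i _ do rewrite /bump /= !add1n rank_weight_rec !mulrBl.
rewrite !sumrB.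
under [X in _ = _ - (_ + X) - _]eq_bigr => i _ do rewrite /bump /= !add1n.
under [X in _ = _ + (_ + X) - _ - _]eq_bigr => i _ do rewrite /bump /= !add1n.
have -> : rank_weight n.+1 0 = 1 by rewrite /rank_weight gbin0 qfall0 mulr1.
have -> : rank_weight n 0 = 1 by rewrite /rank_weight gbin0 qfall0 mulr1.
(* Rank 1 lies below the range of [rank_weight_rec] and is computed directly. *)
have -> : rank_weight n.+1 (bump 0 0) = b ^+ 2 * rank_weight n 1 - (b + 1).
  have b1 : b - 1 != 0 by rewrite subr_eq0 (bX1 (k := 1)).
  have E : forall m, rank_weight m 1 * (b - 1) = (b ^+ m - 1) * (- b ^+ m - 1).
    by move=> m; have := rank_weight_qfall m 1; rewrite !qfallS !qfall0 !expr0 expr1 !mul1r.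
  apply: (mulIf b1); have -> : (b ^+ 2 * rank_weight n 1 - (b + 1)) * (b - 1)
          = b ^+ 2 * (rank_weight n 1 * (b - 1)) - (b + 1) * (b - 1) by ring.
  by rewrite !E exprS; ring.
rewrite /bump /= !addn0 !muln0 !expr0 !muln1.
under eq_bigr => i _ do rewrite (mulrC (b ^+ _)) -mulrA.
under [X in _ + (_ + (_ - X - _)) = _]eq_bigr => i _ do rewrite mulrAC mulrC.
under [X in _ + (_ + (_ - _ - X)) = _]eq_bigr => i _ do rewrite mulrAC mulrC mulrBr.
ring.
Qed.

(** By [qfall_swap], [gbin n k * qfall (b ^+ (n - k)) j] equals [gbin (n - j) k * qfall (b ^+ n) j];
    what remains is [gbin_cauchy] at [w = - b ^+ n]. *)
Lemma sum_rank_weight_qfall n j : (j <= n)%N ->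
  \sum_(k < n.+1) rank_weight n k * qfall (b ^+ (n - k)) j
  = (- b ^+ n) ^+ (n - j) * qfall (b ^+ n) j.
Proof.
move=> lejn; rewrite -(@gbin_cauchy (- b ^+ n) (n - j) n.+1) ?ltnS ?leq_subr // mulr_suml.
apply: eq_bigr => -[k /= ltkn] _; apply: (mulIf (qfall_diag_neq0 k)).
rewrite mulrAC rank_weight_qfall mulrAC qfall_swap //.
by rewrite -(gbin_qfall (n - j) k); ring.
Qed.

End GaussianBinomials.

(** * The quadratic extension *)

Lemma card_le_fibers (T U : finType) (f : T -> U) (A : {set T}) m :
  (forall y, #|[set x in A | f x == y]| <= m)%N -> (#|A| <= #|f @: A| * m)%N.
Proof.
move=> fib; rewrite -sum1_card (partition_big f [in f @: A]) /=; last first.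
  by move=> x Ax; apply: imset_f.
rewrite -sum_nat_const; apply: leq_sum => y _; apply: leq_trans (fib y).
by rewrite -sum1_card; apply: eq_leq; apply: eq_bigl => x; rewrite inE.
Qed.

Lemma card_roots_lt (F : finFieldType) (p : {poly F}) (A : {set F}) :
  p != 0 -> {in A, forall x, root p x} -> (#|A| < size p)%N.
Proof.
move=> p0 rootA; rewrite cardE; apply: max_poly_roots (enum_uniq A) => //.
by apply/allP => x; rewrite mem_enum; apply: rootA.
Qed.

Section Conjugation.
Variables (F : finFieldType) (q : nat) (sigma : {rmorphism F -> F}).
Hypothesis q_gt1 : (1 < q)%N.
Hypothesis cardF : #|F| = (q ^ 2)%N.
Hypothesis sigmaE : forall x, sigma x = x ^+ q.

Definition fixed_field : {set F} := [set x | sigma x == x].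
Notation K := fixed_field.

Lemma fixedP x : reflect (sigma x = x) (x \in K).
Proof. by rewrite inE; apply: eqP. Qed.

Lemma sigmaK : involutive sigma.
Proof. by move=> x; rewrite !sigmaE -exprM mulnn -cardF expf_card. Qed.

Lemma fixed0 : 0 \in K. Proof. by rewrite inE rmorph0. Qed.

Lemma fixed1 : 1 \in K. Proof. by rewrite inE rmorph1. Qed.

Lemma fixedB x y : x \in K -> y \in K -> x - y \in K.
Proof. by move=> /fixedP xK /fixedP yK; apply/fixedP; rewrite rmorphB xK yK. Qed.

Lemma trace_fixed x : x + sigma x \in K.
Proof. by apply/fixedP; rewrite rmorphD sigmaK addrC. Qed.

Lemma norm_fixed x : x * sigma x \in K.
Proof. by apply/fixedP; rewrite rmorphM sigmaK mulrC. Qed.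

Lemma size_addXn m (r : {poly F}) : (size r <= m)%N -> size ('X^m + r) = m.+1.
Proof. by move=> szr; rewrite size_polyDl size_polyXn. Qed.

Lemma card_fixed_le : (#|K| <= q)%N.
Proof.
have sz : size ('X^q - 'X : {poly F}) = q.+1.
  by rewrite size_addXn // size_polyN size_polyX.
rewrite -ltnS -sz; apply: card_roots_lt => [|x /fixedP xK].
  by rewrite -size_poly_eq0 sz.
by rewrite /root !hornerE -sigmaE xK subrr.
Qed.

Lemma card_trace_fiber y : (#|[set x in [set: F] | (x + sigma x == y)%R]| <= q)%N.
Proof.
have sz : size ('X^q + ('X - y%:P) : {poly F}) = q.+1.
  by rewrite size_addXn // size_XsubC.
rewrite -ltnS -sz; apply: card_roots_lt => [|x].
  by rewrite -size_poly_eq0 sz.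
rewrite !inE /= => /eqP <-; rewrite /root hornerD hornerXn hornerXsubC.
by rewrite -sigmaE; apply/eqP; ring.
Qed.

Lemma card_trace_image : (q <= #|[set (x + sigma x)%R | x in [set: F]]|)%N.
Proof.
have := card_le_fibers card_trace_fiber; rewrite cardsT cardF.
by rewrite -mulnn leq_pmul2r // ltnW.
Qed.

Lemma trace_image_sub : [set x + sigma x | x in [set: F]] \subset K.
Proof. by apply/subsetP => _ /imsetP[x _ ->]; apply: trace_fixed. Qed.

(** Fixed points are roots of ['X^q - 'X], which gives at most [q]. The fibres of the trace have at
    most [q] elements, so its image, contained in [K], has at least [q]. Surjectivity of the trace
    follows. *)
Lemma card_fixed : #|K| = q.
Proof.
apply/eqP; rewrite eqn_leq card_fixed_le /=.
exact: leq_trans card_trace_image (subset_leq_card trace_image_sub).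
Qed.

Lemma trace_surj y : y \in K -> exists x, x + sigma x = y.
Proof.
suff -> : K = [set x + sigma x | x in [set: F]] by move=> /imsetP[x _ ->]; exists x.
apply/esym/eqP; rewrite eqEcard trace_image_sub card_fixed.
exact: card_trace_image.
Qed.

Lemma norm_image_sub : [set x * sigma x | x in [set~ 0]] \subset K :\ 0.
Proof.
apply/subsetP => _ /imsetP[x x0 ->]; rewrite !inE in x0 *.
by rewrite mulf_neq0 ?fmorph_eq0 //=; have := norm_fixed x; rewrite inE.
Qed.

Lemma card_fixed_unit : #|K :\ 0| = q.-1.
Proof. by have := cardsD1 0 K; rewrite fixed0 card_fixed => ->. Qed.

Lemma card_unit : #|[set~ (0 : F)]| = (q.-1 * q.+1)%N.
Proof. by rewrite cardsC1 cardF; case: (q) q_gt1 => // m _; lia. Qed.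

(** Norm fibres lie among the roots of a polynomial of degree [q + 1], and
    [q ^ 2 - 1 = (q - 1) * (q + 1)], so every nonzero fixed element must be reached. *)
Lemma norm_surj y : y \in K -> exists x, x * sigma x = y.
Proof.
have [-> _|y0 yK] := eqVneq y 0; first by exists 0; rewrite mul0r.
suff : y \in [set x * sigma x | x in [set~ 0]] by move=> /imsetP[x _ ->]; exists x.
suff -> : [set x * sigma x | x in [set~ 0]] = K :\ 0 by rewrite in_setD1 y0.
apply/eqP; rewrite eqEcard norm_image_sub card_fixed_unit.
have fib (z : F) : (#|[set x in [set~ (0%R : F)] | (x * sigma x == z)%R]| <= q.+1)%N.
  have sz : size ('X^(q.+1) - z%:P : {poly F}) = q.+2.
    by rewrite size_addXn // size_polyN (leq_trans (size_polyC_leq1 _)).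
  rewrite -ltnS -sz; apply: card_roots_lt => [|x].
    by rewrite -size_poly_eq0 sz.
  by rewrite !inE => /andP[_ /eqP zE]; rewrite /root !hornerE exprS -sigmaE zE subrr.
have := card_le_fibers fib; rewrite card_unit.
by rewrite leq_pmul2r.
Qed.

Definition norm1 : {set F} := [set u | u * sigma u == 1].

Lemma card_norm1 : #|norm1| = q.+1.
Proof.
apply/eqP; rewrite eqn_leq; apply/andP; split.
  have sz : size ('X^(q.+1) - 1%:P : {poly F}) = q.+2.
    by rewrite size_addXn // size_polyN (leq_trans (size_polyC_leq1 _)).
  rewrite -ltnS -sz; apply: card_roots_lt => [|x].
    by rewrite -size_poly_eq0 sz.
  by rewrite !inE => /eqP zE; rewrite /root !hornerE exprS -sigmaE zE subrr.
(* A nonempty norm fibre is a translate of [norm1]; at most [q - 1] such fibres cover the nonzero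
   elements, which bounds [norm1] from below. *)
have fib (z : F) : (#|[set x in [set~ (0%R : F)] | (x * sigma x == z)%R]| <= #|norm1|)%N.
  have [->|[c]] := set_0Vmem [set x in [set~ (0 : F)] | x * sigma x == z].
    by rewrite cards0.
  rewrite !inE => /andP[c0 /eqP cz].
  rewrite -(card_imset _ (mulIf (invr_neq0 c0))); apply: subset_leq_card.
  apply/subsetP => _ /imsetP[x + ->]; rewrite !inE => /andP[x0 /eqP xz].
  have sc0 : sigma c != 0 by rewrite fmorph_eq0.
  by rewrite rmorphM fmorphV mulrACA xz -cz -invfM mulfV // mulf_neq0.
have := leq_trans (card_le_fibers fib) (leq_mul (subset_leq_card norm_image_sub) (leqnn _)).
rewrite card_unit card_fixed_unit leq_pmul2l //.
by case: (q) q_gt1 => [|[]].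
Qed.

(** Summing all nontrivial characters at once keeps the values rational. *)
Definition theta (x : F) : rat := q%:R * (x == 0)%:R - 1.

Lemma theta0 : theta 0 = q%:R - 1.
Proof. by rewrite /theta eqxx mulr1. Qed.

Lemma theta_neq0 x : x != 0 -> theta x = -1.
Proof. by move=> /negbTE x0; rewrite /theta x0 mulr0 sub0r. Qed.

Lemma sum_theta_shift a : a \in K -> \sum_(t in K) theta (a + t) = 0.
Proof.
move=> aK; rewrite sumrB sumr_const card_fixed -mulr_sumr.
have NaK : - a \in K by rewrite -sub0r fixedB ?fixed0.
rewrite (bigD1 (- a)) //= subrr eqxx big1 ?addr0 ?mulr1 ?subrr // => t /andP[_ ta].
by rewrite addrC addr_eq0 (negbTE ta).
Qed.

(** This convolution identity makes the kernel [theta (a - a')] a sum of squares. *)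
Lemma sum_theta_mul a a' : a \in K -> a' \in K ->
  \sum_(x in K) theta (a - x) * theta (a' - x) = q%:R * theta (a - a').
Proof.
move=> aK aK'.
have E z : z \in K -> \sum_(x in K) ((z - x == 0)%:R : rat) = 1.
  move=> zK; rewrite (bigD1 z) //= subrr eqxx big1 ?addr0 // => t /andP[_ tz].
  by rewrite subr_eq0 eq_sym (negbTE tz).
have E2 : \sum_(x in K) ((a - x == 0)%:R * (a' - x == 0)%:R : rat) = (a - a' == 0)%:R.
  rewrite (bigD1 a) //= subrr eqxx mul1r big1 ?addr0 => [|t /andP[_ tz]].
    by rewrite subr_eq0 eq_sym subr_eq0.
  by rewrite subr_eq0 eq_sym (negbTE tz) mul0r.
rewrite (eq_bigr (fun x => q%:R ^+ 2 * ((a - x == 0)%:R * (a' - x == 0)%:R)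
    - q%:R * (a - x == 0)%:R - q%:R * (a' - x == 0)%:R + 1)); last first.
  by move=> x _; rewrite /theta; ring.
rewrite big_split !sumrB -!mulr_sumr E2 !E // sumr_const card_fixed /theta /=.
ring.
Qed.

(* Average over the translations [sh t], along which [phi] runs through [K]. *)
Lemma sum_theta_eq0 (T : finZmodType) (S : {set T}) (phi : T -> F) (g : T -> rat)
    (sh : F -> T) :
  (forall t x, t \in K -> (x + sh t \in S) = (x \in S)) ->
  (forall t x, t \in K -> x \in S -> phi (x + sh t) = phi x + t) ->
  (forall t x, t \in K -> x \in S -> g (x + sh t) = g x) ->
  (forall x, x \in S -> phi x \in K) ->
  \sum_(x in S) g x * theta (phi x) = 0.
Proof.
move=> shS shphi shg phiK; set s := \sum_(x in S) _.
have q0 : (q%:R : rat) != 0 by rewrite pnatr_eq0 -lt0n ltnW.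
apply: (mulfI q0); rewrite mulr0 mulr_natl -{1}card_fixed -sumr_const.
transitivity (\sum_(t in K) \sum_(x in S) g x * theta (phi x + t)).
  apply: eq_bigr => t tK; rewrite /s (reindex_inj (addIr (sh t))) /=.
  rewrite (eq_bigl [in S]) => [|x]; last exact: shS.
  by apply: eq_bigr => x xS; rewrite shphi // shg.
rewrite exchange_big big1 // => x xS.
by rewrite -mulr_sumr sum_theta_shift ?mulr0 // phiK.
Qed.

End Conjugation.

(** * Hermitian matrices *)

Lemma card_submx (F : finFieldType) (s m n : nat) (M : 'M[F]_(m, n)) :
  #|[set X : 'M[F]_(s, n) | (X <= M)%MS]| = (#|F| ^ (s * \rank M))%N.
Proof.
rewrite -card_mx -(card_imset _ (row_free_inj (row_base_free M))).
apply: eq_card => X; rewrite inE -(eq_row_base M).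
apply/submxP/imsetP => [[D ->]|[D _ ->]]; by exists D.
Qed.

Lemma rank_adjoin_row (F : fieldType) m n (x : 'rV[F]_n) (M : 'M[F]_(m, n)) :
  ~~ (x <= M)%MS -> \rank (col_mx x M) = (\rank M).+1.
Proof.
move=> xM; have x0 : x != 0 by apply: contraNneq xM => ->; rewrite sub0mx.
have cap0 : (x :&: M)%MS = 0.
  apply/eqP; rewrite -mxrank_eq0; apply: contraNT xM => rk.
  have := mxrank_leqif_eq (capmxSl x M); rewrite rank_rV x0 => -[le1 eq1].
  move: eq1; rewrite eqn_leq le1 lt0n rk /= => /esym/eqmxP eqx.
  by rewrite -eqx capmxSr.
have := mxrank_sum_cap x M; rewrite cap0 mxrank0 addn0 rank_rV x0 => rk.
by rewrite -addsmxE rk.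
Qed.

Section HermitianMatrices.
Variables (F : finFieldType) (q : nat) (sigma : {rmorphism F -> F}).
Hypothesis q_gt1 : (1 < q)%N.
Hypothesis cardF : #|F| = (q ^ 2)%N.
Hypothesis sigmaE : forall x, sigma x = x ^+ q.

Notation K := (fixed_field sigma).
Notation theta := (theta (F := F) q).
Notation b := (- q%:R : rat).
Let sigmaK := sigmaK cardF sigmaE.

Definition star m n (A : 'M[F]_(m, n)) : 'M[F]_(n, m) := (map_mx sigma A)^T.

Lemma starM m n r (A : 'M[F]_(m, n)) (B : 'M[F]_(n, r)) :
  star (A *m B) = star B *m star A.
Proof. by rewrite /star map_mxM trmx_mul. Qed.

Lemma starK m n (A : 'M[F]_(m, n)) : star (star A) = A.
Proof. by apply/matrixP => i j; rewrite !mxE sigmaK. Qed.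

Lemma starD m n (A B : 'M[F]_(m, n)) : star (A + B) = star A + star B.
Proof. by apply/matrixP => i j; rewrite !mxE rmorphD. Qed.

Lemma starB m n (A B : 'M[F]_(m, n)) : star (A - B) = star A - star B.
Proof. by apply/matrixP => i j; rewrite !mxE rmorphB. Qed.

Lemma starZ m n c (A : 'M[F]_(m, n)) : star (c *: A) = sigma c *: star A.
Proof. by apply/matrixP => i j; rewrite !mxE rmorphM. Qed.

Lemma trace_star n (A : 'M[F]_n) : \tr (star A) = sigma (\tr A).
Proof. by rewrite /star mxtrace_tr rmorph_sum; apply: eq_bigr => i _; rewrite mxE. Qed.

Definition herm n : {set 'M[F]_n} := [set A | star A == A].

Lemma hermP n (A : 'M[F]_n) : reflect (star A = A) (A \in herm n).
Proof. by rewrite inE; apply: eqP. Qed.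

Lemma hermD n (A B : 'M[F]_n) : A \in herm n -> B \in herm n -> A + B \in herm n.
Proof. by move=> /hermP hA /hermP hB; apply/hermP; rewrite starD hA hB. Qed.

Lemma hermB n (A B : 'M[F]_n) : A \in herm n -> B \in herm n -> A - B \in herm n.
Proof. by move=> /hermP hA /hermP hB; apply/hermP; rewrite starB hA hB. Qed.

Lemma hermZ n c (A : 'M[F]_n) : c \in K -> A \in herm n -> c *: A \in herm n.
Proof. by move=> /fixedP hc /hermP hA; apply/hermP; rewrite starZ hc hA. Qed.

Lemma herm_trace_mul n (A B : 'M[F]_n) :
  A \in herm n -> B \in herm n -> \tr (A *m B) \in K.
Proof.
move=> /hermP hA /hermP hB; apply/fixedP.
by rewrite -trace_star starM hA hB mxtrace_mulC.
Qed.

Lemma gram_herm n s (V : 'M[F]_(n, s)) : V *m star V \in herm n.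
Proof. by apply/hermP; rewrite starM starK. Qed.

Lemma trace_dual m n (A : 'M[F]_(m, n)) : A != 0 ->
  exists X : 'M[F]_(n, m), \tr (A *m X) = 1.
Proof.
move=> A0; have /existsP[i /existsP[j Aij]] : [exists i, exists j, A i j != 0].
  apply: contraR A0; rewrite negb_exists => /forallP A0.
  apply/eqP/matrixP => i j; rewrite mxE; apply/eqP.
  by have := A0 i; rewrite negb_exists => /forallP/(_ j); rewrite negbK.
exists ((A i j)^-1 *: delta_mx j i).
rewrite -scalemxAr mxtraceZ /mxtrace (bigD1 i) //= big1 ?addr0 => [|k ki].
  rewrite mxE (bigD1 j) //= big1 ?addr0 => [|l lj].
    by rewrite mxE !eqxx mulr1 mulVf.
  by rewrite mxE (negbTE lj) mulr0.
by rewrite mxE big1 // => l _; rewrite mxE (negbTE ki) andbF mulr0.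
Qed.

(** The dual matrix is symmetrized after scaling by an element [a] of trace 1; this works in
    characteristic 2 as well. *)
Lemma herm_dual n (A : 'M[F]_n) : A \in herm n -> A != 0 ->
  exists2 B, B \in herm n & \tr (A *m B) = 1.
Proof.
move=> /hermP hA /trace_dual[X trX].
have [a tra] := trace_surj q_gt1 cardF sigmaE (fixed1 sigma).
exists (a *: X + star (a *: X)).
  by apply/hermP; rewrite starD starK addrC.
rewrite mulmxDr mxtraceD -scalemxAr mxtraceZ trX mulr1.
rewrite -{1}hA -starM -scalemxAl trace_star mxtraceZ (mxtrace_mulC X) trX mulr1.
exact: tra.
Qed.

Lemma herm_separate n (A C : 'M[F]_n) : A \in herm n -> C \in herm n ->
  (forall l, A != l *: C) ->
  exists B, [/\ B \in herm n, \tr (C *m B) = 0 & \tr (A *m B) = 1].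
Proof.
move=> hA hC AC; have A0 : A != 0 by have := AC 0; rewrite scale0r.
have [C0|C0] := eqVneq C 0.
  by have [B hB trB] := herm_dual hA A0; exists B; rewrite C0 mul0mx mxtrace0.
have [C1 hC1 trC1] := herm_dual hC C0.
set l := \tr (A *m C1).
have [|B1 hB1 trB1] := herm_dual (hermB hA (hermZ (herm_trace_mul hA hC1) hC)).
  by rewrite subr_eq0 AC.
(* [B1] is dual to [A - l *: C] and [C1] to [C]; the correction by [C1] kills the pairing with [C]
   and leaves 1 on [A]. *)
exists (B1 - \tr (C *m B1) *: C1); split.
- by rewrite hermB // hermZ // herm_trace_mul.
- by rewrite mulmxBr -scalemxAr linearB /= mxtraceZ trC1 mulr1 subrr.
rewrite mulmxBr -scalemxAr linearB /= mxtraceZ -trB1 mulmxBl linearB /=.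
by rewrite -scalemxAl mxtraceZ mulrC.
Qed.

(** * Gauss sums of Hermitian forms *)

Section GaussSum.
Variables (n s : nat) (B : 'M[F]_n).
Hypothesis hB : B \in herm n.

Definition hform (V : 'M[F]_(n, s)) := \tr (star V *m B *m V).

Definition hform_count y := #|[set V | hform V == y]|.

Lemma hform_fixed V : hform V \in K.
Proof.
apply/fixedP; rewrite /hform -trace_star !starM starK (hermP _ hB).
by rewrite mulmxA.
Qed.

Lemma hformZ c V : hform (c *: V) = c * sigma c * hform V.
Proof.
by rewrite /hform starZ -!scalemxAl -scalemxAr !mxtraceZ mulrA (mulrC c).
Qed.

(** For fixed [U] the increment is affine in [W], which allows averaging over [W]. *)
Lemma hformD U W : hform (W + U) - hform W
  = hform U + (\tr (star U *m B *m W) + sigma (\tr (star U *m B *m W))).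
Proof.
rewrite -trace_star !starM starK (hermP _ hB) /hform starD !mulmxDl !mulmxDr.
by rewrite !mxtraceD mulmxA; ring.
Qed.

Lemma hform_count_unit y : y \in K -> y != 0 -> hform_count y = hform_count 1.
Proof.
move=> yK y0; have [c cy] := norm_surj q_gt1 cardF sigmaE yK.
have c0 : c != 0 by apply: contraNneq y0 => c0; rewrite -cy c0 mul0r.
rewrite /hform_count -[RHS](card_imset _ (scalerI c0)).
apply: eq_card => V; rewrite inE; apply/eqP/imsetP => [fV|[W + ->]].
  exists (c^-1 *: V); last by rewrite scalerA mulfV // scale1r.
  by rewrite inE hformZ fV -cy fmorphV -invfM mulVf // cy.
by rewrite inE => /eqP fW; rewrite hformZ fW mulr1 cy.
Qed.

Lemma hform_count_total :
  (hform_count 0%R + q.-1 * hform_count 1%R = #|F| ^ (n * s))%N.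
Proof.
rewrite -card_mx -[RHS]cardsT -sum1_card (partition_big hform [in K]) /=; last first.
  by move=> V _; apply: hform_fixed.
rewrite (bigD1 0) ?fixed0 //=; congr (_ + _)%N.
  by rewrite /hform_count -sum1_card; apply: eq_bigl => V; rewrite !inE.
rewrite -(card_fixed_unit q_gt1 cardF sigmaE) -sum_nat_const.
apply: eq_big => y; rewrite in_setD1 1?andbC // => /andP[yK y0].
rewrite -(hform_count_unit yK y0) /hform_count -sum1_card.
by apply: eq_bigl => V; rewrite !inE.
Qed.

(** Every nontrivial additive character of [K] has this same sum over the values of the form:
    nonzero values are equidistributed, and the character sums to -1 over them. *)
Definition gauss : int := (hform_count 0)%:Z - (hform_count 1)%:Z.

Lemma sum_theta_hformB y : y \in K ->
  \sum_V theta (hform V - y) = gauss%:~R * theta y.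
Proof.
move=> yK; rewrite sumrB sumr_const -mulr_sumr.
have -> : \sum_(V : 'M_(n, s)) ((hform V - y == 0)%:R : rat) = (hform_count y)%:R.
  rewrite -natr_sum /hform_count -sum1_card; congr _%:R.
  by rewrite [RHS]big_mkcond /=; apply: eq_bigr => V _; rewrite inE subr_eq0; case: eqP.
rewrite card_mx -hform_count_total /gauss.
have [-> |y0] := eqVneq y 0; last rewrite hform_count_unit //.
  rewrite theta0 -[q in q%:R](ltn_predK q_gt1) natrD natrM rmorphB /= -!pmulrn.
  rewrite -natr1; ring.
rewrite theta_neq0 // -[q in q%:R](ltn_predK q_gt1) natrD natrM rmorphB /= -!pmulrn.
rewrite -natr1; ring.
Qed.

Lemma sum_theta_hform : \sum_V theta (hform V) = (q%:R - 1) * gauss%:~R.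
Proof.
rewrite mulrC -(theta0 F) -sum_theta_hformB ?fixed0 //.
by apply: eq_bigr => V _; rewrite subr0.
Qed.

Lemma card_radical :
  #|[set U : 'M[F]_(n, s) | star U *m B == 0]| = (#|F| ^ (s * (n - \rank B)))%N.
Proof.
rewrite -mxrank_ker -card_submx -(card_imset _ (can_inj (@starK n s))).
apply: eq_card => X; rewrite !inE; apply/imsetP/sub_kermxP => [[U + ->]|XB].
  by rewrite inE => /eqP.
by exists (star X); rewrite ?inE ?starK ?XB.
Qed.

(** The sum of [theta (hform V - hform W)] over all pairs is evaluated with [V = W + U]. It averages
    to zero over [W] unless [U] is in the radical of [B], where every term is [q - 1]. *)
Lemma gauss_sqr :
  gauss ^+ 2 = ((q ^ ((2 * n - \rank B) * s)) ^ 2)%N%:Z.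
Proof.
have q1 : (q%:R - 1 : rat) != 0 by rewrite subr_eq0 pnatr_eq1 gtn_eqF.
apply/eqP; rewrite -(eqr_int rat) -(inj_eq (mulfI q1)); apply/eqP.
transitivity (\sum_(W : 'M_(n, s)) \sum_(V : 'M_(n, s)) theta (hform V - hform W)).
  under [RHS]eq_bigr => W _ do rewrite sum_theta_hformB ?hform_fixed //.
  by rewrite -mulr_sumr sum_theta_hform rmorphXn /=; ring.
transitivity (\sum_(U : 'M_(n, s)) \sum_(W : 'M_(n, s)) theta (hform (W + U) - hform W)).
  rewrite [RHS]exchange_big; apply: eq_bigr => W _.
  by rewrite (reindex_inj (addrI W)).
rewrite (bigID [in [set U : 'M[F]_(n, s) | star U *m B == 0]]) /=.
rewrite [X in _ + X]big1 ?addr0 => [|U].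
  rewrite (eq_bigr (fun=> (q%:R - 1) * (#|F| ^ (n * s))%:R)) => [|U].
    rewrite sumr_const card_radical -[LHS]mulr_natr -mulrA -natrM -pmulrn.
    congr (_ * _%:R); rewrite cardF -!expnM -!expnD; congr (_ ^ _)%N.
    by have := rank_leq_row B; nia.
  rewrite inE => /eqP UB; rewrite -card_mx.
  rewrite (eq_bigr (fun=> q%:R - 1)) ?sumr_const ?mulr_natr // => W _.
  by rewrite hformD /hform UB !mul0mx mxtrace0 rmorph0 !addr0 theta0.
rewrite inE => UB0; have [X trX] := trace_dual UB0.
(* Moving [W] along [(t * a) *: X], with [a] of trace 1, shifts the increment by exactly [t]. *)
have [a tra] := trace_surj q_gt1 cardF sigmaE (fixed1 sigma).
rewrite -[LHS](_ : \sum_(W in [set: 'M[F]_(n, s)]) 1 * theta (hform (W + U) - hform W) = _).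
  apply: (sum_theta_eq0 q_gt1 cardF sigmaE (sh := fun t => (t * a) *: X)) => //.
  - by move=> t W _; rewrite !inE.
  - move=> t W /fixedP tK _; rewrite !hformD mulmxDr mxtraceD -scalemxAr mxtraceZ trX.
    by rewrite mulr1 rmorphD rmorphM tK -[t in RHS]mulr1 -tra; ring.
  by move=> W _; rewrite fixedB // hform_fixed.
by rewrite big_mkcond /=; apply: eq_bigr => W _; rewrite inE mul1r.
Qed.

(** The orbits of the [q + 1] norm-one scalars on nonzero matrices are free, and they partition
    [S]. *)
Lemma norm1_orbits (S : {set 'M[F]_(n, s)}) :
  0 \notin S -> (forall u V, u \in norm1 sigma -> V \in S -> u *: V \in S) ->
  (q.+1 %| #|S|)%N.
Proof.
move=> S0 Su; pose R V W := [exists u in norm1 sigma, W == u *: V :> 'M[F]_(n, s)].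
have eqR : {in S & &, equivalence_rel R}.
  have R1 V : R V V.
    by apply/existsP; exists 1; rewrite scale1r inE rmorph1 mulr1 !eqxx.
  have RM V W Z : R V W -> R W Z -> R V Z.
    move=> /existsP[u /andP[u1 /eqP->]] /existsP[v /andP[v1 /eqP->]].
    apply/existsP; exists (v * u); rewrite scalerA eqxx andbT.
    move: u1 v1; rewrite !inE rmorphM => /eqP u1 /eqP v1.
    by rewrite mulrACA u1 v1 mulr1.
  have RV V W : R V W -> R W V.
    move=> /existsP[u /andP[u1 /eqP->]]; rewrite inE in u1.
    have u0 : u != 0 by apply: contraTneq u1 => ->; rewrite mul0r eq_sym oner_eq0.
    apply/existsP; exists u^-1; rewrite scalerA mulVf // scale1r eqxx andbT.
    by rewrite inE fmorphV -invfM (eqP u1) invr1.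
  move=> V W Z _ _ _; split=> [|VW]; first exact: R1.
  by apply/idP/idP; apply: RM => //; apply: RV.
rewrite (card_uniform_partition (n := q.+1) _ (equivalence_partitionP eqR)).
  exact: dvdn_mull.
move=> _ /imsetP[V VS ->]; rewrite -(card_norm1 q_gt1 cardF sigmaE).
have V0 : V != 0 by apply: contraNneq S0 => <-.
have inj : injective (fun u : F => u *: V).
  move=> u v /eqP; rewrite -subr_eq0 -scalerBl scaler_eq0 (negbTE V0) orbF subr_eq0.
  by move/eqP.
rewrite -(card_imset _ inj); apply: eq_card => W; rewrite inE.
apply/andP/imsetP => [[_ /existsP[u /andP[u1 /eqP->]]]|[u u1 ->]]; first by exists u.
by split; [apply: Su | apply/existsP; exists u; rewrite u1 eqxx].
Qed.

Lemma hform_scale_norm1 u V : u \in norm1 sigma -> hform (u *: V) = hform V.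
Proof. by rewrite inE => /eqP u1; rewrite hformZ u1 mul1r. Qed.

(** The zero matrix, lying over the value 0, accounts for the 1; the rest of both fibres is
    divisible by [q + 1]. *)
Lemma gauss_mod : (q.+1%:Z %| gauss - 1)%Z.
Proof.
have d1 : (q.+1 %| hform_count 1%R)%N.
  apply: norm1_orbits => [|u V u1].
    by rewrite inE /hform mulmx0 mxtrace0 eq_sym oner_eq0.
  by rewrite !inE hform_scale_norm1.
have d0 : (q.+1 %| #|[set V : 'M[F]_(n, s) | hform V == 0%R] :\ 0%R|)%N.
  apply: norm1_orbits => [|u V u1]; first by rewrite !inE eqxx.
  rewrite !inE hform_scale_norm1 // scaler_eq0 => /andP[V0 ->].
  rewrite (negbTE V0) orbF andbT; apply: contraTneq u1 => ->.
  by rewrite inE mul0r eq_sym oner_eq0.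
have -> : gauss - 1 = #|[set V : 'M[F]_(n, s) | hform V == 0] :\ 0|%:Z
                      - (hform_count 1)%:Z.
  have h0 : hform 0 = 0 by rewrite /hform mulmx0 mxtrace0.
  rewrite /gauss {1}/hform_count (cardsD1 0 [set V | hform V == 0]) inE h0 eqxx.
  by rewrite /= add1n intS; ring.
by rewrite rpredB.
Qed.

(* [gauss_sqr] determines the sum up to sign, and [- q = 1] modulo [q + 1]. *)
Lemma gaussE : gauss = (- q%:Z) ^+ ((2 * n - \rank B) * s).
Proof.
set m := (_ * s)%N.
have : (gauss == (- q%:Z) ^+ m) || (gauss == - (- q%:Z) ^+ m).
  rewrite -eqf_sqr gauss_sqr -/m -[X in X == _]natz !natrX natz.
  by rewrite [X in _ == X]exprAC sqrrN exprAC.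
case/orP => /eqP // Eg; have := gauss_mod; rewrite Eg.
have d1 : (q.+1%:Z %| (- q%:Z) ^+ m - 1)%Z.
  by rewrite subrX1 dvdz_mulr //; apply/dvdzP; exists (-1); rewrite intS; ring.
move=> d2; have := rpredD d1 d2.
(* The wrong sign would make [q + 1] divide 2. *)
by rewrite (_ : _ + _ = - 2); [rewrite dvdzE /= => /dvdn_leq; lia | ring].
Qed.

End GaussSum.

(** The exponent [2 n - r] is split as [n + (n - r)] to isolate the dependence on the rank. *)
Lemma sum_theta_hform_rank n s (B : 'M[F]_n) : B \in herm n ->
  \sum_(V : 'M_(n, s)) theta (hform B V)
  = (q%:R - 1) * (b ^+ n) ^+ s * (b ^+ (n - \rank B)) ^+ s.
Proof.
move=> hB; rewrite sum_theta_hform // gaussE // -mulrA; congr (_ * _).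
rewrite -exprMn -exprD -exprM rmorphXn /= rmorphN /= -pmulrn; congr (_ ^+ (_ * _)).
by have := rank_leq_row B; lia.
Qed.

Lemma sum_herm_rank_theta n s (A : 'M[F]_n) : A \in herm n -> (s < \rank A)%N ->
  \sum_(B in herm n) (b ^+ (n - \rank B)) ^+ s * theta (\tr (A *m B)) = 0.
Proof.
move=> hA sA.
have q0 : b != 0 by rewrite oppr_eq0 pnatr_eq0 -lt0n ltnW.
have c0 : (q%:R - 1) * (b ^+ n) ^+ s != 0.
  by rewrite mulf_neq0 ?expf_neq0 // subr_eq0 pnatr_eq1 gtn_eqF.
apply: (mulfI c0); rewrite mulr0 mulr_sumr.
transitivity (\sum_(B in herm n) \sum_(V : 'M_(n, s))
    theta (\tr (V *m star V *m B)) * theta (\tr (A *m B))).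
  apply: eq_bigr => B hB; rewrite mulrA -sum_theta_hform_rank // mulr_suml.
  by apply: eq_bigr => V _; rewrite /hform [in LHS]mxtrace_mulC mulmxA.
rewrite exchange_big big1 //= => V _.
(* As [V *m star V] has rank at most [s], [A] is not a multiple of it. Translating along [B0] then
   changes only the second factor. *)
have [l|B0 [hB0 trV trA]] := herm_separate hA (gram_herm V).
  apply: contraTneq sA => ->; rewrite -leqNgt.
  rewrite (leq_trans (mxrank_scale _ _)) //.
  exact: leq_trans (mxrankM_maxl _ _) (rank_leq_col _).
apply: (sum_theta_eq0 q_gt1 cardF sigmaE (sh := fun t => t *: B0)).
- move=> t B tK; apply/idP/idP => hB; last by rewrite hermD // hermZ.
  by rewrite -(addrK (t *: B0) B) hermB // hermZ.
- by move=> t B _ _; rewrite mulmxDr mxtraceD -scalemxAr mxtraceZ trA mulr1.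
- by move=> t B _ _; rewrite mulmxDr mxtraceD -scalemxAr mxtraceZ trV mulr0 addr0.
by move=> B hB; apply: herm_trace_mul.
Qed.

(** * Rank distribution *)

Definition border n (a : F) (x : 'rV[F]_n) (B : 'M[F]_n) : 'M[F]_(1 + n) :=
  block_mx a%:M x (star x) B.

Lemma border_herm n a (x : 'rV[F]_n) B :
  (border a x B \in herm (1 + n)) = (B \in herm n) && (a \in K).
Proof.
have E : star (border a x B) = border (sigma a) x (star B).
  rewrite /border /star map_block_mx tr_block_mx map_scalar_mx tr_scalar_mx.
  by congr block_mx; apply: starK.
apply/hermP/andP => [|[/hermP hB /fixedP aK]]; last by rewrite E hB aK.
rewrite E /border => /eq_block_mx[/(congr1 (fun M : 'M[F]_1 => M 0 0))].
by rewrite !mxE eqxx !mulr1n => aK _ _ hB; split; [apply/hermP | apply/fixedP].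
Qed.

Lemma sum_herm_border n (f : 'M[F]_(1 + n) -> rat) :
  \sum_(B in herm (1 + n)) f B =
  \sum_(B in herm n) \sum_(x : 'rV[F]_n) \sum_(a in K) f (border a x B).
Proof.
under [RHS]eq_bigr => B _ do rewrite pair_big /=.
rewrite pair_big /=.
pose h (p : 'M[F]_n * ('rV[F]_n * F)) := border p.2.2 p.2.1 p.1.
pose h' (M : 'M[F]_(1 + n)) := (drsubmx M, (ursubmx M, ulsubmx M 0 0)).
rewrite (reindex_onto h h') => [|M hM].
  apply: eq_bigl => -[B [x a]]; rewrite /h /h' /= border_herm.
  rewrite /border block_mxKdr block_mxKur block_mxKul mxE eqxx mulr1n.
  by rewrite eqxx andbT.
rewrite /h /h' /border /= -{5}[M]submxK; congr block_mx.
  by apply/matrixP => i j; rewrite !ord1 [in LHS]mxE eqxx mulr1n.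
rewrite -{2}(hermP _ hM); apply/matrixP => i j.
by rewrite !mxE.
Qed.

(** Elimination with the Schur complement [a - w B w^*] reduces the matrix to block diagonal
    form. *)
Lemma rank_border_in n a (w : 'rV[F]_n) B : B \in herm n ->
  \rank (border a (w *m B) B) = ((a != (w *m B *m star w)%R 0%R 0%R) + \rank B)%N.
Proof.
move=> /hermP hB.
have -> : border a (w *m B) B = block_mx 1%:M w 0 1%:M
   *m (block_mx (a%:M - w *m B *m star w) 0 0 B *m block_mx 1%:M 0 (star w) 1%:M).
  rewrite !mulmx_block !mul1mx !mulmx1 !mul0mx !mulmx0 !addr0 !add0r mulmxA subrK.
  by rewrite /border starM hB.
have U1 : block_mx 1%:M w 0 1%:M \in unitmx by rewrite unitmxE det_ublock !det1 mulr1 unitr1.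
have U2 : block_mx 1%:M 0 (star w) 1%:M \in unitmx.
  by rewrite unitmxE det_lblock !det1 mulr1 unitr1.
rewrite eqmxMfull ?row_full_unit // mxrankMfree ?row_free_unit //.
rewrite rank_diag_block_mx rank_rV subr_eq0; congr (~~ _ + _)%N.
apply/eqP/eqP => [<-|->]; first by rewrite mxE eqxx mulr1n.
by apply/matrixP => i j; rewrite !ord1 [in LHS]mxE eqxx mulr1n.
Qed.

(** The new row is independent of the old ones, and by conjugate symmetry so is the new column: each
    adds 1. *)
Lemma rank_border_notin n a (x : 'rV[F]_n) B : B \in herm n ->
  ~~ (x <= B)%MS -> \rank (border a x B) = (\rank B).+2.
Proof.
move=> /hermP hB xB; rewrite /border block_mxEv rank_adjoin_row.
  rewrite -mxrank_tr tr_row_mx trmxK -{1}hB trmxK rank_adjoin_row ?map_submx //.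
  by rewrite mxrank_map.
apply: contra xB => /submxP[D]; rewrite mul_mx_row => /eq_row_mx[_ ->].
exact: submxMl.
Qed.

(** If [x] is in the row space of [B], one corner keeps the rank and [q - 1 = - (b + 1)] corners add
    1. Otherwise all [q = - b] corners add 2. *)
Lemma sum_rank_border n (B : 'M[F]_n) (g : nat -> rat) : B \in herm n ->
  \sum_(x : 'rV[F]_n) \sum_(a in K) g (\rank (border a x B)) =
  b ^+ (2 * \rank B) * g (\rank B)
    - (b + 1) * b ^+ (2 * \rank B) * g (\rank B).+1
    - b * (b ^+ (2 * n) - b ^+ (2 * \rank B)) * g (\rank B).+2.
Proof.
move=> hB; have cardq m : (#|F| ^ m)%:R = b ^+ (2 * m) :> rat.
  by rewrite cardF -expnM exprM sqrrN -exprM natrX.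
pose S := [set x : 'rV[F]_n | (x <= B)%MS].
have cS : #|S|%:R = b ^+ (2 * \rank B) :> rat by rewrite card_submx mul1n cardq.
have cSC : #|~: S|%:R = b ^+ (2 * n) - b ^+ (2 * \rank B) :> rat.
  apply/eqP; rewrite eq_sym subr_eq -cS -natrD addnC cardsC card_mx mul1n cardq.
  exact: eqxx.
rewrite (bigID [in S]) /=.
rewrite (eq_bigr (fun=> g (\rank B) - (b + 1) * g (\rank B).+1)) => [|x].
  rewrite sumr_const -[X in X + _]mulr_natl cS.
  rewrite (eq_bigr (fun=> q%:R * g (\rank B).+2)) => [|x].
    rewrite (eq_bigl [in ~: S]) => [|x]; last by rewrite in_setC.
    by rewrite sumr_const -[X in _ + X]mulr_natl cSC; ring.
  rewrite inE => xB.
  rewrite (eq_bigr (fun=> g (\rank B).+2)) => [|a _]; last by rewrite rank_border_notin.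
  by rewrite sumr_const (card_fixed q_gt1 cardF sigmaE) mulr_natl.
rewrite inE => /submxP[w ->]; set c := (w *m B *m star w) 0 0.
have cK : c \in K.
  apply/fixedP; rewrite -[LHS](_ : star (w *m B *m star w) 0 0 = _); last first.
    by rewrite [LHS]mxE [LHS]mxE.
  by rewrite !starM starK (hermP _ hB) mulmxA.
rewrite (bigD1 c) //= rank_border_in // eqxx add0n; congr (_ + _).
rewrite (eq_bigr (fun=> g (\rank B).+1)) => [|a /andP[_ ac]]; last first.
  by rewrite rank_border_in // ac add1n.
rewrite sumr_const (_ : #|_| = q.-1); last first.
  have := cardsD1 c K; rewrite cK (card_fixed q_gt1 cardF sigmaE) => -> /=.
  by apply: eq_card => a; rewrite in_setD1 andbC.
rewrite -mulr_natl -[q in RHS](ltn_predK q_gt1) -natr1; ring.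
Qed.

Lemma b_neq0 : b != 0.
Proof. by rewrite oppr_eq0 pnatr_eq0 -lt0n ltnW. Qed.

Lemma b_expr_neq1 k : (0 < k)%N -> b ^+ k != 1.
Proof.
move=> k0; apply/negP => /eqP/(congr1 (fun x : rat => `|x|)).
rewrite normrX normrN normr_nat normr1 => /eqP.
by rewrite -natrX pnatr_eq1 => /eqP qk; have := ltn_expl k q_gt1; lia.
Qed.

Lemma sum_herm_rank n (g : nat -> rat) :
  \sum_(B in herm n) g (\rank B) = \sum_(k < n.+1) rank_weight b n k * g k.
Proof.
elim: n g => [|n IHn] g.
  rewrite big_ord1 (bigD1 0) /= => [|]; last by apply/hermP; rewrite flatmx0 [RHS]flatmx0.
  rewrite big1 => [|B /andP[_]]; last by rewrite [B]flatmx0 eqxx.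
  by rewrite mxrank0 addr0 /rank_weight gbin0 qfall0 !mul1r.
rewrite (sum_rank_weightS b_neq0 b_expr_neq1).
(* The induction hypothesis is applied to the test function transformed by bordering. *)
rewrite -(IHn (fun k => b ^+ (2 * k) * g k - (b + 1) * b ^+ (2 * k) * g k.+1
  - b * (b ^+ (2 * n) - b ^+ (2 * k)) * g k.+2)).
rewrite (@sum_herm_border n (fun B => g (\rank B))).
by apply: eq_bigr => B hB; rewrite sum_rank_border.
Qed.

Lemma sum_herm_qfall n j : (j <= n)%N ->
  \sum_(B in herm n) qfall b (b ^+ (n - \rank B)) j
  = (- b ^+ n) ^+ (n - j) * qfall b (b ^+ n) j.
Proof.
move=> lejn; rewrite (@sum_herm_rank n (fun r => qfall b (b ^+ (n - r)) j)).
exact: (sum_rank_weight_qfall b_neq0 b_expr_neq1).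
Qed.

(** * The linear programming bound *)

Lemma sum_theta_psd (T : finType) (Y : {set T}) (phi : T -> F) :
  {in Y, forall A, phi A \in K} ->
  0 <= \sum_(A in Y) \sum_(A' in Y) theta (phi A - phi A').
Proof.
move=> phiK; have q0 : (0 : rat) < q%:R by rewrite ltr0n ltnW.
rewrite -(pmulr_rge0 _ q0).
suff -> : q%:R * (\sum_(A in Y) \sum_(A' in Y) theta (phi A - phi A'))
  = \sum_(x in K) (\sum_(A in Y) theta (phi A - x)) ^+ 2.
  by apply: sumr_ge0 => x _; apply: sqr_ge0.
under [RHS]eq_bigr => x _ do rewrite expr2 mulr_suml.
rewrite [RHS]exchange_big mulr_sumr; apply: eq_bigr => A AY.
under [RHS]eq_bigr => x _ do rewrite mulr_sumr.
rewrite [RHS]exchange_big mulr_sumr; apply: eq_bigr => A' AY' /=.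
by rewrite (sum_theta_mul q_gt1 cardF sigmaE) ?phiK.
Qed.

(** The sum of [P * D] over Hermitian [B] is estimated twice, where [D] is the nonnegative transform
    of the pairs of codewords. *)
Lemma lp_bound n d (Y : {set 'M[F]_n}) (P : {poly rat}) :
  Y != set0 -> {subset Y <= herm n} ->
  {in Y &, forall A B, A != B -> (d <= \rank (A - B)%R)%N} ->
  (size P <= d)%N -> (forall k, (k <= n)%N -> 0 <= P.[b ^+ (n - k)]) ->
  #|Y|%:R * P.[b ^+ n] <= \sum_(B in herm n) P.[b ^+ (n - \rank B)].
Proof.
move=> Y0 hY dY szP P0.
have Ygt0 : (0 : rat) < #|Y|%:R by rewrite ltr0n card_gt0.
have q1 : (0 : rat) < q%:R - 1 by rewrite subr_gt0 ltr1n.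
pose D B := \sum_(A in Y) \sum_(A' in Y) theta (\tr (A *m B) - \tr (A' *m B)).
have D0 : D 0 = (q%:R - 1) * #|Y|%:R * #|Y|%:R.
  rewrite /D (eq_bigr (fun=> (q%:R - 1) * #|Y|%:R)) ?sumr_const ?mulr_natr // => A _.
  rewrite (eq_bigr (fun=> q%:R - 1)) ?sumr_const ?mulr_natr // => A' _.
  by rewrite !mulmx0 subrr theta0.
have h0 : 0 \in herm n.
  by apply/hermP/matrixP => i j; rewrite !mxE rmorph0.
(* Only the term [B = 0] is kept. *)
have lower : (q%:R - 1) * #|Y|%:R * #|Y|%:R * P.[b ^+ n]
    <= \sum_(B in herm n) P.[b ^+ (n - \rank B)] * D B.
  rewrite (bigD1 0) //= mxrank0 subn0 D0 (mulrC P.[_]) lerDl.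
  apply: sumr_ge0 => B /andP[hB _]; rewrite mulr_ge0 ?P0 ?rank_leq_row //.
  by apply: sum_theta_psd => A AY; apply: herm_trace_mul (hY _ AY) hB.
(* Pairs [A != A'] contribute nothing: each monomial of [P] has degree below [d], hence below the
   rank of [A - A']. *)
have upper : \sum_(B in herm n) P.[b ^+ (n - \rank B)] * D B
    = (q%:R - 1) * #|Y|%:R * \sum_(B in herm n) P.[b ^+ (n - \rank B)].
  transitivity (\sum_(A in Y) \sum_(A' in Y) \sum_(B in herm n)
      P.[b ^+ (n - \rank B)] * theta (\tr ((A - A') *m B))).
    under [LHS]eq_bigr => B _ do rewrite /D mulr_sumr.
    rewrite exchange_big; apply: eq_bigr => A _ /=.
    under [LHS]eq_bigr => B _ do rewrite mulr_sumr.
    rewrite exchange_big; apply: eq_bigr => A' _ /=.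
    by apply: eq_bigr => B _; rewrite mulmxBl linearB.
  rewrite [RHS]mulrAC [RHS]mulr_natr -sumr_const; apply: eq_bigr => A AY.
  rewrite (bigD1 A) //= [X in _ + X]big1 ?addr0 => [|A' /andP[AY' AA']].
    by rewrite mulr_sumr; apply: eq_bigr => B _; rewrite subrr mul0mx mxtrace0 theta0 mulrC.
  under eq_bigr => B _ do rewrite horner_coef mulr_suml.
  rewrite exchange_big big1 //= => -[i /= ltiP] _.
  under eq_bigr => B _ do rewrite -mulrA.
  rewrite -mulr_sumr sum_herm_rank_theta ?mulr0 ?hermB ?hY //.
  by apply: leq_trans ltiP (leq_trans szP _); rewrite dY // eq_sym.
move: lower; rewrite upper -!mulrA ler_pM2l // ler_pM2l //.
Qed.

(** * Signs at powers of [b], and the choice of polynomial *)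

Let q_ge1 : (1 : rat) <= q%:R.
Proof. by rewrite ler1n ltnW. Qed.

Lemma bX_sign m : b ^+ m = (-1) ^+ m * q%:R ^+ m.
Proof. exact: exprNn. Qed.

(** Factors are taken in consecutive pairs. Up to a square, a pair is [(b ^+ r - 1) * (b ^+ r - b)],
    and no power of [b] lies strictly between [b] and 1. *)
Lemma qfall_even_ge0 m j : ~~ odd j -> 0 <= qfall b (b ^+ m) j.
Proof.
move=> /even_halfK <-; elim: (j./2) => [|i IHi]; first by rewrite qfall0.
rewrite doubleS !qfallS -mulrA.
have [ltmi|leim] := ltnP m i.*2; first by rewrite qfall_expr0 // mul0r.
rewrite mulr_ge0 // -(subnKC leim); move: (m - i.*2)%N => r.
have -> : (b ^+ (i.*2 + r) - b ^+ i.*2) * (b ^+ (i.*2 + r) - b ^+ i.*2.+1)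
        = (b ^+ i.*2) ^+ 2 * ((b ^+ r - 1) * (b ^+ r - b)) by rewrite exprD exprS; ring.
rewrite mulr_ge0 ?sqr_ge0 // bX_sign -signr_odd.
case r_odd: (odd r); rewrite ?expr0 ?expr1 ?mul1r ?mulN1r.
  have : q%:R <= q%:R ^+ r :> rat by case: r r_odd => // r _; apply: ler_eXnr.
  by move: q_ge1; nra.
have : 1 <= q%:R ^+ r :> rat by rewrite exprn_ege1.
by move: q_ge1; nra.
Qed.

Lemma qfall_expr_neq0 n j : (j <= n)%N -> qfall b (b ^+ n) j != 0.
Proof.
move=> lejn; apply/prodf_neq0 => -[i /= ltij] _.
rewrite -(subnKC (leq_trans (ltnW ltij) lejn)) exprD -{2}[b ^+ i]mulr1 -mulrBr.
rewrite mulf_neq0 ?expf_neq0 ?b_neq0 // subr_eq0 b_expr_neq1 // subn_gt0.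
exact: leq_trans ltij lejn.
Qed.

(** After multiplication by the sign, the second term is [q ^+ n]. The first can be negative only
    for odd [k], and then its size is at most [q ^+ n]. *)
Lemma linear_factor_ge0 n k : (k <= n.+1)%N ->
  0 <= (-1) ^+ n.+1 * (b ^+ (n.+1 - k) - b ^+ n).
Proof.
move=> lekn.
have -> : (-1) ^+ n.+1 * (b ^+ (n.+1 - k) - b ^+ n)
        = (-1) ^+ k * q%:R ^+ (n.+1 - k) + q%:R ^+ n.
  rewrite mulrBr !bX_sign !mulrA -exprD -exprD.
  congr (_ * _ + _).
    by rewrite -[LHS]signr_odd oddD oddB // addbA addbb addFb signr_odd.
  by rewrite addSn addnn exprS -muln2 mulnC exprM sqrrN !expr1n; ring.
have qn : 0 <= q%:R ^+ n :> rat by rewrite exprn_ge0 ?ler0n.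
have qk : 0 <= q%:R ^+ (n.+1 - k) :> rat by rewrite exprn_ge0 ?ler0n.
rewrite -signr_odd; case k_odd: (odd k); rewrite ?expr0 ?expr1 ?mul1r ?mulN1r.
  rewrite addrC subr_ge0 ler_weXn2l //.
  by case: k k_odd {lekn qk} => // k _; lia.
exact: addr_ge0.
Qed.

Lemma code_bound n d (Y : {set 'M[F]_n}) :
  ~~ odd d -> (2 <= d <= n)%N -> Y != set0 -> {subset Y <= herm n} ->
  {in Y &, forall A B, A != B -> (d <= \rank (A - B)%R)%N} ->
  #|Y|%:R <= (-1) ^+ (n + 1) * q%:R ^+ (n * (n - d + 1)) *
    (((b ^+ (n - d + 2) - 1) + b ^+ n * (b ^+ (n - d + 1) - 1))
     / (b ^+ (n - d + 2) - b ^+ (n - d + 1))).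
Proof.
move=> d_even /andP[d2 dn] Y0 hY dY.
have [j dE] : exists j, d = j.+2 by case: (d) d2 => [|[|j]] // _; exists j.
have [e nE] : exists e, n = (e + j).+2 by exists (n - j.+2)%N; lia.
(* The product vanishes at the ranks above [n - d + 2], and the last factor at rank 1. *)
pose P : {poly rat} := (-1) ^+ n *: ((\prod_(i < j) ('X - (b ^+ i)%:P)) * ('X - (b ^+ n.-1)%:P)).
have PE y : P.[y] = qfall b y j * ((-1) ^+ n * (y - b ^+ n.-1)).
  rewrite /P hornerZ hornerM hornerXsubC horner_prod mulrCA; congr (_ * _).
  by apply: eq_bigr => i _; rewrite hornerXsubC.
have szP : (size P <= d)%N.
  rewrite (leq_trans (size_scale_leq _ _)) // (leq_trans (size_polyMleq _ _)) //.
  by rewrite size_prod_XsubC size_XsubC /index_enum -enumT size_enum_ord dE addn2.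
have j_even : ~~ odd j by move: d_even; rewrite dE /= negbK.
have P0 k : (k <= n)%N -> 0 <= P.[b ^+ (n - k)].
  move=> kn; rewrite PE mulr_ge0 ?qfall_even_ge0 //.
  by rewrite nE /= linear_factor_ge0 // -nE.
have := lp_bound Y0 hY dY szP P0; rewrite PE.
set t := b ^+ (e.+1); set u := b ^+ j; set X := b ^+ n.
have XE : X = t * u * b by rewrite /X nE -addSn exprSr exprD.
have uE : b ^+ n.-1 = t * u by rewrite nE -exprD /= addSn.
have b0 := b_neq0.
have b1 : b - 1 != 0 by rewrite subr_eq0 (b_expr_neq1 (k := 1)).
have t0 : t != 0 by rewrite expf_neq0.
have u0 : u != 0 by rewrite expf_neq0.
pose f := qfall b X j; pose W := (- X) ^+ e.+1.
have f0 : f != 0 by rewrite qfall_expr_neq0 // nE; lia.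
(* Writing [y - t * u = (y - u) + (u - t * u)] expands [P] in falling factorials of lengths [j + 1]
   and [j], whose sums are known. *)
have -> : \sum_(B in herm n) P.[b ^+ (n - \rank B)]
   = (-1) ^+ n * (W * (f * (X - u)) + (u - t * u) * (W * (- X) * f)).
  transitivity ((-1) ^+ n * ((\sum_(B in herm n) qfall b (b ^+ (n - \rank B)) j.+1)
     + (u - t * u) * (\sum_(B in herm n) qfall b (b ^+ (n - \rank B)) j))).
    rewrite [(u - _) * _]mulr_sumr -big_split mulr_sumr /=; apply: eq_bigr => B _.
    by rewrite PE qfallS uE -/u; ring.
  rewrite !sum_herm_qfall ?qfallS; try by rewrite nE; lia.
  rewrite (_ : n - j.+1 = e.+1)%N; last by rewrite nE; lia.
  rewrite (_ : n - j = e.+2)%N; last by rewrite nE; lia.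
  by rewrite /W (exprSr _ e.+1).
have c0 : 0 < f * ((-1) ^+ n * (X - b ^+ n.-1)).
  rewrite lt_neqAle eq_sym; apply/andP; split.
    rewrite !mulf_neq0 ?signr_eq0 // XE uE.
    by rewrite (_ : _ - _ = t * u * (b - 1)); [rewrite !mulf_neq0 | ring].
  by have := P0 0%N isT; rewrite PE subn0.
rewrite -ler_pdivlMr // => /le_trans; apply; rewrite le_eqVlt; apply/orP; left; apply/eqP.
have -> : (n - d + 2 = e.+2)%N by rewrite nE dE; lia.
have -> : (n - d + 1 = e.+1)%N by rewrite nE dE; lia.
rewrite -/X (exprSr _ e.+1) -/t.
(* Since [d] is even, [e + 1] and [n + 1] have the same parity, so [(-1) ^+ (n + 1)] is unchanged by
   raising to the power [e + 1]. *)
have -> : (-1) ^+ (n + 1) * q%:R ^+ (n * e.+1) = W.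
  have -> : W = ((-1) ^+ n.+1 * q%:R ^+ n) ^+ e.+1.
    by rewrite /W /X bX_sign (exprS (-1) n) mulN1r mulNr.
  rewrite exprMn -!exprM addn1; congr (_ * _).
  rewrite -[LHS]signr_odd -[RHS]signr_odd oddM nE /= oddD (negbTE j_even).
  by rewrite addbF !negbK andbb.
have sn : (-1) ^+ n != 0 :> rat by rewrite signr_eq0.
rewrite -/f uE XE; field.
have E c : c * b - c = c * (b - 1) by ring.
by rewrite !E !mulf_eq0 !negb_or t0 u0 b1 sn f0.
Qed.

End HermitianMatrices.

Unset Implicit Arguments.

Theorem theorem3p2 (p k : nat) (F : finFieldType) (n d : nat)
  (Y : {set 'M[F]_n}) :
  prime p -> (0 < k)%N ->
  #|F| = ((p ^ k) ^ 2)%N ->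
  (2 <= n)%N -> ~~ odd d -> (2 <= d)%N -> (d <= n)%N ->
  d_code (p ^ k) d Y ->
  let q : rat := (p ^ k)%:R in
  (#|Y|%:R : rat) <=
    (-1) ^+ (n + 1) * q ^+ (n * (n - d + 1)) *
    ((((- q) ^+ (n - d + 2) - 1) + (- q) ^+ n * ((- q) ^+ (n - d + 1) - 1))
     / ((- q) ^+ (n - d + 2) - (- q) ^+ (n - d + 1))).
Proof.
move=> p_pr k_gt0 cardF _ d_even d2 dn [Y0 hY dY]; cbv zeta.
have q_gt1 : (1 < p ^ k)%N.
  by rewrite -(expn0 p) ltn_exp2l // prime_gt1.
have pF : p \in [pchar F].
  by apply: (@card_finPcharP F p (k * 2)) => //; rewrite cardF expnM.
pose frob (x : F) := x ^+ (p ^ k).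
(* Additivity holds because the exponent is a power of the characteristic; this makes the
   conjugation a ring morphism. *)
have frobD : {morph frob : x y / x + y}.
  move=> x y; apply: exprDn_pchar; rewrite pnatX; apply/orP; left.
  by rewrite (eq_pnat _ (pcharf_eq pF)) pnat_id.
have frobM : {morph frob : x y / x * y} by move=> x y; apply: exprMn.
have frobB : {morph frob : x y / x - y}.
  by move=> x y; apply: (addIr (frob y)); rewrite -frobD !subrK.
pose sigma : {rmorphism F -> F} := HB.pack frob
  (GRing.isZmodMorphism.Build F F frob frobB)
  (GRing.isMonoidMorphism.Build F F frob (Logic.conj (expr1n F (p ^ k)) frobM)).
have sigmaE x : sigma x = x ^+ (p ^ k) by [].
apply: (@code_bound F (p ^ k) sigma) => //; first by rewrite d2.
move=> A AY; apply/hermP/matrixP => i j; rewrite !mxE [RHS](hY A AY).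
exact: sigmaE.
Qed.
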